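(* Let $\mathbb{F}$ be a field of characteristic zero, let $n$ be a positive integer, and let $\big(g(x),F(x)\big)$ be an element of the Riordan group $\mathcal{R}(\mathbb{F})$ with $g(x) = g_0 + g_rx^r + g_{r+1}x^{r+1} + \cdots$ and $F(x) = f_1x + f_2x^2 + \cdots$, where $g(x)$ is non-constant ($g_0 \neq 0$, $r > 0$ and $g_r \neq 0$) and $(f_1)^n = 1$. Then $$\big(g(x),F(x)\big)^n = (1,x) \iff g(x)\cdot g\big(F(x)\big)\cdots g\big(F^{(n-1)}(x)\big) = 1.$$
   Context: The Riordan group $\mathcal{R}(\mathbb{F})$ consists of the pairs $\big(g(x),F(x)\big)$ of formal power series over $\mathbb{F}$ with $g(x) = g_0 + g_1x + \cdots$, $g_0 \neq 0$, and $F(x) = f_1x + f_2x^2 + \cdots$, $f_1 \neq 0$ (identified with the infinite lower triangular matrix whose $(m,n)$ entry, $m,n\ge 0$, is the coefficient of $x^m$ in $g(x)F(x)^n$). Multiplication is $\big(g(x),F(x)\big)\cdot\big(h(x),K(x)\big) = \big(g(x)\cdot h(F(x)),\, K(F(x))\big)$, and the identity is $(1,x)$. $F^{(k)}(x)$ denotes the $k$-fold composition $F(F(\cdots F(x)\cdots))$ (with $F^{(0)}(x) = x$), so the product in the claim is $\prod_{j=0}^{n-1} g\big(F^{(j)}(x)\big)$. *)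

(* Defs.v *)
From HB Require Import structures.
From mathcomp Require Import all_boot all_order all_algebra all_fingroup.
From mathcomp Require Import boolp.

Set Implicit Arguments.
Unset Strict Implicit.
Unset Printing Implicit Defensive.

Import GRing.Theory.
Local Open Scope ring_scope.

(* Formal power series: a i is the coefficient of x^i in a.
   Equality, hence eqType and choiceType, is classical. *)
Record fps (R : Type) := Fps { fps_coef :> nat -> R }.

HB.instance Definition _ (R : Type) := gen_eqMixin (fps R).
HB.instance Definition _ (R : Type) := gen_choiceMixin (fps R).

Lemma fpsP (R : Type) (a b : fps R) : a =1 b -> a = b.
Proof. by case: a b => [a] [b] /= /funext ->. Qed.

Section FpsRing.
Variable R : comNzRingType.
Implicit Types (a b c f g h : fps R) (p q : {poly R}).

Definition fps_zero : fps R := Fps (fun=> 0).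
Definition fps_opp a : fps R := Fps (fun i => - a i).
Definition fps_add a b : fps R := Fps (fun i => a i + b i).

Fact fps_addA : associative fps_add.
Proof. by move=> a b c; apply/fpsP => i /=; rewrite addrA. Qed.
Fact fps_addC : commutative fps_add.
Proof. by move=> a b; apply/fpsP => i /=; rewrite addrC. Qed.
Fact fps_add0 : left_id fps_zero fps_add.
Proof. by move=> a; apply/fpsP => i /=; rewrite add0r. Qed.
Fact fps_addN : left_inverse fps_zero fps_opp fps_add.
Proof. by move=> a; apply/fpsP => i /=; rewrite addNr. Qed.

HB.instance Definition _ :=
  GRing.isZmodule.Build (fps R) fps_addA fps_addC fps_add0 fps_addN.

Definition fps_one : fps R := Fps (fun i => (i == 0)%:R).
Definition fps_mul a b : fps R :=
  Fps (fun m => \sum_(i < m.+1) a i * b (m - i)%N).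

Definition fps_of_poly p : fps R := Fps (fun i => p`_i).
Definition fps_trunc N a : {poly R} := \poly_(i < N) a i.

Lemma fps_truncE N a m : (m < N)%N -> fps_of_poly (fps_trunc N a) m = a m.
Proof. by move=> mN; rewrite /= coef_poly mN. Qed.

Lemma fps_mul_congr N a a' b b' :
    (forall i, (i < N)%N -> a i = a' i) -> (forall i, (i < N)%N -> b i = b' i) ->
  forall i, (i < N)%N -> fps_mul a b i = fps_mul a' b' i.
Proof.
move=> ha hb m mN /=; apply: eq_bigr => i _; rewrite ha ?hb //.
  exact: leq_ltn_trans (leq_subr _ _) mN.
exact: leq_ltn_trans (leq_ord i) mN.
Qed.

Lemma fps_of_polyM p q :
  fps_of_poly (p * q) = fps_mul (fps_of_poly p) (fps_of_poly q).
Proof. by apply/fpsP => m /=; rewrite coefM. Qed.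

Fact fps_mulA : associative fps_mul.
Proof.
move=> a b c; apply/fpsP => m; have mm := ltnSn m.
set t := fun a => fps_of_poly (fps_trunc m.+1 a).
have tE (d : fps R) i : (i < m.+1)%N -> d i = t d i by move=> hi; rewrite /t fps_truncE.
have tM (d e : fps R) i : (i < m.+1)%N -> fps_mul d e i = fps_mul (t d) (t e) i.
  by move=> hi; apply: (fps_mul_congr (N := m.+1)) => // j; apply: tE.
rewrite (fps_mul_congr (tE a) (tM b c)) // (fps_mul_congr (tM a b) (tE c)) //.
by rewrite -!fps_of_polyM mulrA.
Qed.

Fact fps_mulC : commutative fps_mul.
Proof.
move=> a b; apply/fpsP => m /=; rewrite (reindex_inj rev_ord_inj) /=.
apply: eq_bigr => i _; rewrite mulrC subSS subKn //.
exact: leq_ord.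
Qed.

Fact fps_mul1 : left_id fps_one fps_mul.
Proof.
move=> a; apply/fpsP => m /=; rewrite big_ord_recl /= mul1r subn0 big1 ?addr0 //.
by move=> i _; rewrite mul0r.
Qed.

Fact fps_mulDl : left_distributive fps_mul fps_add.
Proof.
move=> a b c; apply/fpsP => m /=; rewrite -big_split /=.
by apply: eq_bigr => i _; rewrite mulrDl.
Qed.

Fact fps_one_neq0 : fps_one != 0.
Proof.
apply/eqP => /(congr1 (fun a : fps R => a 0%N)) /= /eqP.
by rewrite oner_eq0.
Qed.

HB.instance Definition _ := GRing.Zmodule_isComNzRing.Build (fps R)
  fps_mulA fps_mulC fps_mul1 fps_mulDl fps_one_neq0.

Definition fpsX : fps R := Fps (fun i => (i == 1)%:R).

(* The substitution h(f(x)), for f without constant term: the powers f^k with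
   k > m do not contribute to the coefficient of x^m (cf. fps_comp_widen).
   The value is meaningless when f 0 <> 0. *)
Definition fps_comp h f : fps R :=
  Fps (fun m => \sum_(k < m.+1) h k * (f ^+ k : fps R) m).

Definition fps_iter f k : fps R := iter k (fps_comp f) fpsX.

Lemma fpsM_coef a b m : (a * b) m = \sum_(i < m.+1) a i * b (m - i)%N.
Proof. by []. Qed.

Lemma fps1_coef m : (1 : fps R) m = (m == 0)%:R.
Proof. by []. Qed.

Lemma fpsM_coef0 a b : (a * b) 0%N = a 0%N * b 0%N.
Proof. by rewrite fpsM_coef big_ord_recl big_ord0 addr0. Qed.

Lemma fps_exp_small f k m : f 0%N = 0 -> (m < k)%N -> (f ^+ k) m = 0.
Proof.
move=> f0; elim: k m => // k IH m mk; rewrite exprS fpsM_coef.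
rewrite big1 // => -[[|i] im] _ /=.
  by rewrite f0 mul0r.
rewrite IH ?mulr0 //; move: im mk; rewrite !ltnS.
by case: m => // m _ mk; rewrite subSS (leq_ltn_trans (leq_subr _ _)).
Qed.

Lemma fps_exp_diag f m : f 0%N = 0 -> (f ^+ m) m = f 1%N ^+ m.
Proof.
move=> f0; elim: m => [|m IH]; first by rewrite !expr0.
rewrite !exprS fpsM_coef 2!big_ord_recl /= f0 mul0r add0r /bump /= subn1 /= IH.
rewrite big1 ?addr0 // => i _; rewrite fps_exp_small ?mulr0 // subSS.
case: m i {IH} => [|m] i; first by case: i.
by rewrite ltn_subrL.
Qed.

Lemma fps_comp_widen h f m N : f 0%N = 0 -> (m < N)%N ->
  fps_comp h f m = \sum_(k < N) h k * (f ^+ k) m.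
Proof.
move=> f0 mN /=; rewrite (big_ord_widen N (fun k => h k * (f ^+ k) m)) //.
rewrite [RHS](bigID (fun i : 'I_N => (i < m.+1)%N)) /= [X in _ + X]big1 ?addr0 //.
by move=> i; rewrite -leqNgt => mi; rewrite fps_exp_small ?mulr0.
Qed.

Lemma fps_comp_coef0 h f : fps_comp h f 0%N = h 0%N.
Proof. by rewrite /= big_ord_recl big_ord0 addr0 /= mulr1. Qed.

Lemma fps_comp_coef1 h f : f 0%N = 0 -> fps_comp h f 1%N = h 1%N * f 1%N.
Proof.
by move=> f0; rewrite /= !big_ord_recl big_ord0 /= addr0 mulr0 add0r.
Qed.

Lemma fps_of_polyX p k : fps_of_poly (p ^+ k) = fps_of_poly p ^+ k.
Proof.
elim: k => [|k IH]; last by rewrite !exprS fps_of_polyM IH.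
by apply/fpsP => i; rewrite /= coef1.
Qed.

Lemma fps_of_poly_comp p q : q`_0 = 0 ->
  fps_of_poly (p \Po q) = fps_comp (fps_of_poly p) (fps_of_poly q).
Proof.
move=> q0; apply/fpsP => m; set N := maxn m.+1 (size p).
rewrite (@fps_comp_widen _ _ _ N) ?leq_maxl //= coef_comp_poly.
rewrite (big_ord_widen N (fun k => p`_k * (q ^+ k)`_m)) ?leq_maxr //.
rewrite [RHS](bigID (fun i : 'I_N => (i < size p)%N)) /= [X in _ + X]big1 ?addr0 //.
  by apply: eq_bigr => i _; rewrite -fps_of_polyX.
by move=> i; rewrite -leqNgt => /(nth_default 0) ->; rewrite mul0r.
Qed.

Lemma fps_exp_congr N a a' k :
    (forall i, (i < N)%N -> a i = a' i) ->
  forall i, (i < N)%N -> (a ^+ k) i = (a' ^+ k) i.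
Proof. by move=> h; elim: k => // k IH i iN; rewrite !exprS (fps_mul_congr h IH). Qed.

Lemma fps_comp_congr N a a' b b' :
    (forall i, (i < N)%N -> a i = a' i) -> (forall i, (i < N)%N -> b i = b' i) ->
  forall i, (i < N)%N -> fps_comp a b i = fps_comp a' b' i.
Proof.
move=> ha hb m mN /=; apply: eq_bigr => i _.
by rewrite ha ?(fps_exp_congr _ hb) // (leq_ltn_trans (leq_ord i) mN).
Qed.

Lemma fps_compM h (k : fps R) f : f 0%N = 0 ->
  fps_comp (h * k) f = fps_comp h f * fps_comp k f.
Proof.
move=> f0; apply/fpsP => m; have mm := ltnSn m.
set t := fun a => fps_of_poly (fps_trunc m.+1 a).
have tE (d : fps R) i : (i < m.+1)%N -> d i = t d i by move=> hi; rewrite /t fps_truncE.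
have t0 : (fps_trunc m.+1 f)`_0 = 0 by rewrite coef_poly.
have hM := fps_mul_congr (tE h) (tE k).
rewrite (fps_comp_congr hM (tE f)) //.
have hc d := fps_comp_congr (tE d) (tE f).
rewrite [RHS](fps_mul_congr (hc h) (hc k)) //.
by rewrite -fps_of_polyM -!fps_of_poly_comp // -fps_of_polyM -rmorphM.
Qed.

Lemma fps_compA h (k : fps R) f : k 0%N = 0 -> f 0%N = 0 ->
  fps_comp (fps_comp h k) f = fps_comp h (fps_comp k f).
Proof.
move=> k0 f0; apply/fpsP => m; have mm := ltnSn m.
set t := fun a => fps_of_poly (fps_trunc m.+1 a).
have tE (d : fps R) i : (i < m.+1)%N -> d i = t d i by move=> hi; rewrite /t fps_truncE.
have t0 (d : fps R) : d 0%N = 0 -> (fps_trunc m.+1 d)`_0 = 0 by move=> d0; rewrite coef_poly.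
have hc d e := fps_comp_congr (tE d) (tE e).
rewrite (fps_comp_congr (hc h k) (tE f)) // (fps_comp_congr (tE h) (hc k f)) //.
rewrite -!fps_of_poly_comp ?comp_polyA ?t0 //.
have := congr1 (fun a : fps R => a 0%N) (fps_of_poly_comp (fps_trunc m.+1 k) (t0 f f0)).
by rewrite fps_comp_coef0 /= t0.
Qed.

Lemma fps_comp1 f : fps_comp 1 f = 1.
Proof.
apply/fpsP => m /=; rewrite big_ord_recl /= mul1r big1 ?addr0 //.
by move=> i _; rewrite mul0r.
Qed.

Lemma fps_compXl f : f 0%N = 0 -> fps_comp fpsX f = f.
Proof.
move=> f0; apply/fpsP => m; rewrite (@fps_comp_widen _ _ _ m.+2) //.
rewrite !big_ord_recl /= mul0r add0r expr1 mul1r big1 ?addr0 // => i _.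
by rewrite mul0r.
Qed.

Lemma fpsX_exp k m : (fpsX ^+ k) m = (m == k)%:R.
Proof.
elim: k m => [|k IH] m; first by rewrite expr0.
rewrite exprS fpsM_coef big_ord_recl /= mul0r add0r.
case: m => [|m]; first by rewrite big_ord0.
rewrite big_ord_recl /= mul1r IH subSS subn0 big1 ?addr0 // => i _.
by rewrite mul0r.
Qed.

Lemma fps_compXr h : fps_comp h fpsX = h.
Proof.
apply/fpsP => m /=; rewrite big_ord_recr /= fpsX_exp eqxx mulr1 big1 ?add0r //.
by move=> i _; rewrite fpsX_exp gtn_eqF ?mulr0.
Qed.

Lemma fps_mul_comp_coef g f h m : f 0%N = 0 ->
  (g * fps_comp h f) m = \sum_(k < m.+1) h k * (g * f ^+ k) m.
Proof.
move=> f0; rewrite fpsM_coef.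
transitivity (\sum_(i < m.+1) \sum_(k < m.+1) h k * (g i * (f ^+ k) (m - i)%N)).
  apply: eq_bigr => i _; rewrite (@fps_comp_widen _ _ _ m.+1) ?ltnS ?leq_subr //.
  by rewrite mulr_sumr; apply: eq_bigr => k _; rewrite mulrCA.
by rewrite exchange_big; apply: eq_bigr => k _; rewrite fpsM_coef mulr_sumr.
Qed.

End FpsRing.

Arguments fpsX {R}.

Section RiordanGroup.
Variable F : fieldType.
Implicit Types (g f h t : fps F).

(* The solution h of g(x) h(f(x)) = t(x), i.e. of the lower triangular system
   sum_(k <= m) h_k [x^m](g f^k) = t_m. *)
Fixpoint fps_solve_seq g f t n : seq F :=
  if n is m.+1 then
    let s := fps_solve_seq g f t m in
    rcons s ((t m - \sum_(k < m) s`_k * (g * f ^+ k) m) / (g * f ^+ m) m)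
  else [::].

Definition fps_solve g f t : fps F := Fps (fun k => (fps_solve_seq g f t k.+1)`_k).

Lemma size_fps_solve_seq g f t n : size (fps_solve_seq g f t n) = n.
Proof. by elim: n => //= n IH; rewrite size_rcons IH. Qed.

Lemma nth_fps_solve_seq g f t n k : (k < n)%N ->
  (fps_solve_seq g f t n)`_k = fps_solve g f t k.
Proof.
elim: n => // n IH; rewrite ltnS leq_eqVlt => /orP[/eqP-> //|kn].
by rewrite [fps_solve_seq _ _ _ _]/= nth_rcons size_fps_solve_seq kn IH.
Qed.

Lemma fps_solveP g f t : g 0%N != 0 -> f 0%N = 0 -> f 1%N != 0 ->
  g * fps_comp (fps_solve g f t) f = t.
Proof.
move=> g0 f0 f1; apply/fpsP => m; rewrite fps_mul_comp_coef // big_ord_recr.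
have dE : (g * f ^+ m) m = g 0%N * f 1%N ^+ m.
  rewrite fpsM_coef big_ord_recl subn0 fps_exp_diag // big1 ?addr0 // => i _.
  rewrite fps_exp_small ?mulr0 //= /bump /=.
  by case: m i => [|m] i; [case: i|rewrite ltn_subrL].
have d0 : (g * f ^+ m) m != 0 by rewrite dE mulf_neq0 // expf_neq0.
have -> : fps_solve g f t m =
    (t m - \sum_(k < m) fps_solve g f t k * (g * f ^+ k) m) / (g * f ^+ m) m.
  rewrite {1}/fps_solve [LHS]/= nth_rcons size_fps_solve_seq ltnn eqxx.
  congr ((_ - _) / _); apply: eq_bigr => k _.
  by rewrite nth_fps_solve_seq.
by rewrite divfK // [LHS]addrC; exact: subrK.
Qed.

Definition is_riordan (u : fps F * fps F) : bool :=
  [&& u.1 0%N != 0, u.2 0%N == 0 & u.2 1%N != 0].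

Record riordan := Riordan { riordan_val : fps F * fps F;
                            riordanP : is_riordan riordan_val }.

HB.instance Definition _ := [isSub for riordan_val].
HB.instance Definition _ := [Choice of riordan by <:].

Definition riordan_g (u : riordan) : fps F := (riordan_val u).1.
Definition riordan_F (u : riordan) : fps F := (riordan_val u).2.

Lemma riordan_g0 u : riordan_g u 0%N != 0.
Proof. by case/and3P: (riordanP u). Qed.
Lemma riordan_F0 u : riordan_F u 0%N = 0.
Proof. by case/and3P: (riordanP u) => _ /eqP. Qed.
Lemma riordan_F1 u : riordan_F u 1%N != 0.
Proof. by case/and3P: (riordanP u). Qed.

Fact is_riordan_one : is_riordan (1, fpsX).
Proof. by rewrite /is_riordan /= eqxx !oner_eq0. Qed.

Definition riordan_one := Riordan is_riordan_one.

Fact is_riordan_mul (u v : riordan) :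
  is_riordan (riordan_g u * fps_comp (riordan_g v) (riordan_F u),
              fps_comp (riordan_F v) (riordan_F u)).
Proof.
apply/and3P; split=> [||].
- by rewrite fpsM_coef0 fps_comp_coef0 mulf_neq0 ?riordan_g0.
- by rewrite fps_comp_coef0 riordan_F0.
- by rewrite fps_comp_coef1 ?riordan_F0 // mulf_neq0 ?riordan_F1.
Qed.

Definition riordan_mul (u v : riordan) := Riordan (is_riordan_mul u v).

Fact is_riordan_inv (u : riordan) :
  is_riordan (fps_solve (riordan_g u) (riordan_F u) 1,
              fps_solve 1 (riordan_F u) fpsX).
Proof.
have [g0 F0 F1] := And3 (riordan_g0 u) (riordan_F0 u) (riordan_F1 u).
have := fps_solveP 1 g0 F0 F1.
have := fps_solveP fpsX (oner_neq0 F : (1 : fps F) 0%N != 0) F0 F1.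
rewrite mul1r => hK hg; apply/and3P; split=> [||].
- have := congr1 (fun a : fps F => a 0%N) hg.
  rewrite fpsM_coef0 fps_comp_coef0 fps1_coef /= => h; apply/eqP => h0.
  by move: h; rewrite h0 mulr0 => /esym/eqP; rewrite oner_eq0.
- by have := congr1 (fun a : fps F => a 0%N) hK; rewrite fps_comp_coef0 => ->.
- have := congr1 (fun a : fps F => a 1%N) hK.
  rewrite fps_comp_coef1 // => h; apply/eqP => h0.
  by move: h; rewrite h0 mul0r => /esym/eqP; rewrite oner_eq0.
Qed.

Definition riordan_inv (u : riordan) := Riordan (is_riordan_inv u).

Fact riordan_mulA : associative riordan_mul.
Proof.
move=> u v w; apply: val_inj; congr pair => /=.
  rewrite {1}/riordan_g [in LHS]/= fps_compM ?riordan_F0 // mulrA.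
  by rewrite fps_compA ?riordan_F0.
by rewrite /riordan_F /= fps_compA ?riordan_F0.
Qed.

Fact riordan_mul1 : right_id riordan_one riordan_mul.
Proof.
move=> [[g f] fP]; apply: val_inj; congr pair => /=.
  by rewrite fps_comp1 mulr1.
by rewrite fps_compXl // riordan_F0.
Qed.

Fact riordan_1mul : left_id riordan_one riordan_mul.
Proof.
by move=> [[g f] fP]; apply: val_inj; congr pair => /=; rewrite fps_compXr ?mul1r.
Qed.

Fact riordan_mulV : right_inverse riordan_one riordan_inv riordan_mul.
Proof.
move=> u; have [g0 F0 F1] := And3 (riordan_g0 u) (riordan_F0 u) (riordan_F1 u).
apply: val_inj; congr pair => /=; first exact: fps_solveP.
by rewrite -[LHS]mul1r [LHS]fps_solveP ?oner_neq0.
Qed.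

Fact riordan_Vmul : left_inverse riordan_one riordan_inv riordan_mul.
Proof.
move=> u; set v := riordan_inv u.
suff uE : u = riordan_inv v by rewrite [X in riordan_mul _ X]uE riordan_mulV.
rewrite -[u]riordan_mul1 -(riordan_mulV v) riordan_mulA riordan_mulV.
by rewrite riordan_1mul.
Qed.

HB.instance Definition _ := isGroup.Build riordan
  riordan_mulA riordan_1mul riordan_mul1 riordan_Vmul riordan_mulV.

Lemma riordan_gM (u v : riordan) :
  riordan_g (u * v)%g = riordan_g u * fps_comp (riordan_g v) (riordan_F u).
Proof. by []. Qed.

Lemma riordan_FM (u v : riordan) :
  riordan_F (u * v)%g = fps_comp (riordan_F v) (riordan_F u).
Proof. by []. Qed.

Lemma riordan_val1 : riordan_val 1%g = (1, fpsX).
Proof. by []. Qed.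

End RiordanGroup.

(* Main.v *)
(* The group power u^n is (P, G) with P the product of the theorem and G the
   n-th compositional iterate of F.  If P = 1, comparing the first components of
   u^n u = u u^n gives g(G(x)) = g(x).  If G(x) = x + c x^k + ... with k > 1, then
   the coefficient of x^(r+k-1) in g(G(x)) - g(x) is r g_r c; hence c = 0 in
   characteristic zero, and G(x) = x. *)
Require Import Defs.
From HB Require Import structures.
From mathcomp Require Import all_boot all_order all_algebra all_fingroup.

Set Implicit Arguments.
Unset Strict Implicit.
Unset Printing Implicit Defensive.

Import GRing.Theory.
Local Open Scope ring_scope.

Section FpsOrder.
Variable R : comNzRingType.
Implicit Types a b f g : fps R.

Lemma fps_sum_coef (I : Type) (s : seq I) (a : I -> fps R) m :
  (\sum_(i <- s) a i) m = \sum_(i <- s) a i m.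
Proof. by elim/big_ind2: _ => // ? ? ? ? <- <-. Qed.

Lemma fpsM_coef_small a b p q m :
    (forall i, (i < p)%N -> a i = 0) -> (forall i, (i < q)%N -> b i = 0) ->
  (m < p + q)%N -> (a * b) m = 0.
Proof.
move=> a0 b0 mpq; rewrite fpsM_coef big1 // => i _.
have [ip|pi] := ltnP i p; first by rewrite a0 ?mul0r.
by rewrite b0 ?mulr0 // ltn_subLR ?leq_ord // (leq_trans mpq) ?leq_add2r.
Qed.

(** Only the index [i = p] escapes both [i < p] and [p + q - i < q]. *)
Lemma fpsM_coef_lead a b p q :
    (forall i, (i < p)%N -> a i = 0) -> (forall i, (i < q)%N -> b i = 0) ->
  (a * b) (p + q)%N = a p * b q.
Proof.
move=> a0 b0; have ppq : (p < (p + q).+1)%N by rewrite ltnS leq_addr.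
rewrite fpsM_coef (bigD1 (Ordinal ppq)) //= addKn big1 ?addr0 // => i.
rewrite -val_eqE /= neq_ltn => /orP[ip|pi]; first by rewrite a0 ?mul0r.
by rewrite b0 ?mulr0 // ltn_subLR ?leq_ord // ltn_add2r.
Qed.

Section TangentToIdentity.
Variables (f : fps R) (k : nat).
Hypotheses (f0 : f 0%N = 0) (f1 : f 1%N = 1).
Hypothesis f_low : forall i, (i < k)%N -> f i = fpsX i.

Let sub_low i : (i < k)%N -> (f - fpsX) i = 0.
Proof. by move=> ik; rewrite [LHS]/= f_low ?subrr. Qed.

(** The cofactor of [f - fpsX] in [f ^+ j - fpsX ^+ j], in the form that [subrXX] produces. *)
Let geom j : fps R := \sum_(i < j) f ^+ (j.-1 - i) * fpsX ^+ i.

Let geom_small j m : (m < j.-1)%N -> geom j m = 0.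
Proof.
move=> mj; rewrite fps_sum_coef big1 // => i _.
apply: (@fpsM_coef_small _ _ (j.-1 - i) i).
- by move=> l; apply: fps_exp_small.
- by move=> l; apply: fps_exp_small.
- by rewrite subnK // -ltnS (ltn_predK (ltn_ord i)).
Qed.

(** Each of the [j] summands contributes 1, because [f] and [fpsX] both have linear coefficient
    1. *)
Let geom_lead j : geom j j.-1 = j%:R.
Proof.
rewrite fps_sum_coef -[in RHS](card_ord j) -sumr_const; apply: eq_bigr => i _.
have ij : (i <= j.-1)%N by rewrite -ltnS (ltn_predK (ltn_ord i)).
transitivity ((f ^+ (j.-1 - i) * fpsX ^+ i) (j.-1 - i + i)%N).
  by rewrite (subnK ij).
rewrite fpsM_coef_lead.
- by rewrite !fps_exp_diag // f1 !expr1n mulr1.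
- by move=> l; apply: fps_exp_small.
- by move=> l; apply: fps_exp_small.
Qed.

Lemma fps_expBX_small j m : (m < k + j.-1)%N -> (f ^+ j - fpsX ^+ j) m = 0.
Proof.
by rewrite subrXX => mj; apply: fpsM_coef_small sub_low _ mj; apply: geom_small.
Qed.

Lemma fps_expBX_lead j :
  (f ^+ j - fpsX ^+ j) (k + j.-1)%N = (f - fpsX) k *+ j.
Proof.
rewrite subrXX (fpsM_coef_lead sub_low); last exact: geom_small.
by rewrite [X in _ * X]geom_lead mulr_natr.
Qed.

(** Expand [g(f(x)) - g(x)] as the sum of [g j * (f ^+ j - fpsX ^+ j)]. The term [j = 0] cancels,
    those with [0 < j < r] have [g j = 0], and those with [j > r] start beyond degree [k + r.-1];
    only [j = r] is left. *)
Lemma fps_compB_lead g r : (0 < r)%N ->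
    (forall i, (0 < i < r)%N -> g i = 0) ->
  (fps_comp g f - g) (k + r.-1)%N = g r * ((f - fpsX) k *+ r).
Proof.
move=> r_gt0 g_low.
move m_def: (k + r.-1)%N => m.
(* The summation range has to contain [r] as well as the indices up to [m]: for [k = 0], [m] is only
   [r.-1]. *)
have mN : (m < (m + r).+1)%N by rewrite ltnS leq_addr.
have rN : (r < (m + r).+1)%N by rewrite ltnS leq_addl.
transitivity (\sum_(j < (m + r).+1) g j * (f ^+ j - fpsX ^+ j) m).
  transitivity (fps_comp g f m - fps_comp g fpsX m); first by rewrite fps_compXr.
  rewrite !(fps_comp_widen _ _ mN) // -sumrB.
  by apply: eq_bigr => j _; rewrite -mulrBr.
have := fps_expBX_lead r; rewrite m_def => lead_r.
have m_lt j : (r < j)%N -> (m < k + j.-1)%N.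
  by rewrite -m_def ltn_add2l => rj; rewrite -ltnS !prednK // (ltn_trans r_gt0).
rewrite (bigD1 (Ordinal rN)) // lead_r big1 ?[LHS]addr0 // => j /andP[_].
rewrite -val_eqE neq_ltn => /orP[jr|rj].
  case: (posnP j) => [->|j_gt0]; first by rewrite !expr0 subrr mulr0.
  by rewrite g_low ?mul0r // j_gt0.
by rewrite fps_expBX_small ?mulr0 ?m_lt.
Qed.

End TangentToIdentity.
End FpsOrder.

Lemma fps_comp_fix_eqX (F : fieldType) (f g : fps F) (r : nat) :
    [pchar F] =i pred0 -> f 0%N = 0 -> f 1%N = 1 -> (0 < r)%N ->
    (forall i, (0 < i < r)%N -> g i = 0) -> g r != 0 ->
  fps_comp g f = g -> f = fpsX.
Proof.
move=> charF0 f0 f1 r_gt0 g_low g_r gf; apply/fpsP.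
(* Strong induction on the degree: once [f] agrees with x below [k], the vanishing coefficient of
   degree [k + r.-1] forces agreement at [k]. The cases [k = 0] and [k = 1] need no separate
   treatment. *)
elim/ltn_ind=> k f_low.
have := fps_compB_lead f0 f1 f_low r_gt0 g_low.
rewrite gf subrr => /esym/eqP.
rewrite mulf_eq0 (negPf g_r) -mulr_natr mulf_eq0.
by rewrite (pcharf0P F).1 // eqn0Ngt r_gt0 orbF subr_eq0 => /eqP.
Qed.

Section RiordanPowers.
Variable F : fieldType.
Implicit Type u : riordan F.

(** Splitting off the last factor [u] puts its [F] outermost, which is how [fps_iter] unfolds. *)
Lemma riordan_F_exp u k : riordan_F (u ^+ k)%g = fps_iter (riordan_F u) k.
Proof. by elim: k => // k IH; rewrite expgSr riordan_FM IH. Qed.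

Lemma riordan_g_exp u k :
  riordan_g (u ^+ k)%g =
  \prod_(j < k) fps_comp (riordan_g u) (fps_iter (riordan_F u) j).
Proof.
elim: k => [|k IH]; first by rewrite big_ord0.
by rewrite expgSr riordan_gM IH riordan_F_exp big_ord_recr.
Qed.

Lemma riordan_F1_exp u k : riordan_F (u ^+ k)%g 1%N = riordan_F u 1%N ^+ k.
Proof.
elim: k => // k IH.
by rewrite expgSr riordan_FM fps_comp_coef1 ?riordan_F0 // IH exprS.
Qed.

End RiordanPowers.

Theorem theorem3p1 (F : fieldType) (charF0 : [pchar F] =i pred0)
    (n : nat) (n_gt0 : (0 < n)%N) (u : riordan F)
    (r : nat) (r_gt0 : (0 < r)%N)
    (g_low : forall i : nat, (0 < i < r)%N -> riordan_g u i = 0)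
    (g_r : riordan_g u r != 0)
    (f1_n : (riordan_F u 1%N) ^+ n = 1) :
  (u ^+ n)%g = 1%g <->
  \prod_(j < n) fps_comp (riordan_g u) (fps_iter (riordan_F u) j) = 1.
Proof.
rewrite -riordan_g_exp; split=> [-> //|gn1].
have Fn_fix : fps_comp (riordan_g u) (riordan_F (u ^+ n)%g) = riordan_g u.
  have := congr1 (@riordan_g F) (etrans (esym (expgSr u n)) (expgS u n)).
  by rewrite !riordan_gM gn1 mul1r fps_comp1 mulr1.
have FnX : riordan_F (u ^+ n)%g = fpsX.
  apply: fps_comp_fix_eqX charF0 (riordan_F0 _) _ r_gt0 g_low g_r Fn_fix.
  (* The linear coefficient of the iterate is the [n]-th power of that of [F], so [f1_n] makes it
     1. *)
  by rewrite riordan_F1_exp.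
apply: val_inj; rewrite [RHS]riordan_val1 -gn1 -FnX.
exact: surjective_pairing.
Qed.
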